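(* In the setting described in the context, let $C$ be a convex cone in $Y$ with $\mathrm{int}(C)\neq\emptyset$ such that $f(A)$ is $C$-convex, that is, $f(A)+C$ is a convex subset of $Y$. Then there exist finitely many (possibly zero) polyhedra $F_1,\dots,F_p$ in $X$ satisfying the following properties: (i) $S^w=\bigcup_{k=1}^pF_k$. (ii) For each $k$ there exists $i\in\bar I$ such that $F_k$ is a face of $A_i$ and $F_k\subset S^w_i$, where $\bar I:=\{i\in\overline{1m}:A_i\neq\emptyset\}$ and $S^w_i$ is the weak Pareto solution set of the linear subproblem $(\mathrm{LP})_i$. Consequently each $F_k$ is a weak Pareto face of the linear subproblem $(\mathrm{LP})_i$ for some $i\in\bar I$.
   Context: Notation. $\overline{1m}:=\{1,\dots,m\}$; $\mathcal{L}(X,Y)$ is the space of continuous linear operators. A polyhedron in a normed space $W$ is the solution set of finitely many inequalities $\langle u^*,x\rangle\le s$ with $u^*\in W^*$, $s\in\mathbb{R}$. A face of a polyhedron $P$ means an exposed face: a set $\{u\in P:\langle x^*,u\rangle=\sup_{x\in P}\langle x^*,x\rangle\}$ for some $x^*\in W^*$ (possibly $0$). $\mathcal{PL}(X,Y)$ is the set of $f:X\to Y$ such that $X$ is a finite union of polyhedra $P_i$ with $f=T_i+b_i$ on $P_i$ for some $T_i\in\mathcal{L}(X,Y)$, $b_i\in Y$. For $\Omega\subset Y$, $\mathrm{WE}(\Omega,C)$ is the set of $\omega\in\Omega$ for which there is no $v\in\Omega$ with $\omega-v\in\mathrm{int}(C)$. Setting. $X,Y$ are normed spaces, $f\in\mathcal{PL}(X,Y)$,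 $\varphi_1,\dots,\varphi_l\in\mathcal{PL}(X,\mathbb{R})$. Problem (PLP): $C$-Min $f(x)$ subject to $\varphi_j(x)\le0$, $j\in\overline{1l}$. Its feasible set is $A:=\{x\in X:\varphi_j(x)\le0\ \forall j\in\overline{1l}\}$ and its weak Pareto solution set is $S^w:=\{x\in A:f(x)\in\mathrm{WE}(f(A),C)\}$. Fixed data: $T_i\in\mathcal{L}(X,Y)$, $u_{ik}^*,x_{ij}^*\in X^*$, $b_i\in Y$, $t_{ik},c_{ij}\in\mathbb{R}$ ($i\in\overline{1m}$, $k\in\overline{1q_i}$, $j\in\overline{1l}$) with $P_i=\{x\in X:\langle u_{ik}^*,x\rangle\le t_{ik}\ \forall k\in\overline{1q_i}\}$, $X=\bigcup_{i=1}^mP_i$, $\mathrm{int}(P_i)\neq\emptyset$, $P_i\cap\mathrm{int}(P_{i'})=\emptyset$ for $i\neq i'$, and $f=T_i+b_i$, $\varphi_j=x_{ij}^*-c_{ij}$ on $P_i$ for all $i,j$. For $i\in\overline{1m}$, $A_i:=\{x\in P_i:\langle x_{ij}^*,x\rangle\le c_{ij}\ \forall j\in\overline{1l}\}$, and $(\mathrm{LP})_i$ is: $C$-min $T_ix+b_i$ subject to $x\in A_i$, with weak Pareto solution set $S_i^w:=\{x\in A_i:T_ix+b_i\in\mathrm{WE}(T_i(A_i)+b_i,C)\}$. A weak Pareto face of $(\mathrm{LP})_i$ is a face of $A_i$ contained in $S_i^w$. *)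

(* Defs.v *)
From HB Require Import structures.
From mathcomp Require Import all_boot all_order all_algebra.
From mathcomp Require Import all_classical all_reals all_analysis.

Set Implicit Arguments.
Unset Strict Implicit.
Unset Printing Implicit Defensive.

Import Order.TTheory GRing.Theory Num.Theory.
Import numFieldNormedType.Exports.

Local Open Scope classical_set_scope.
Local Open Scope ring_scope.

(* The dual of a normed space W is rendered as {linear W -> R^o} together with
   a continuity hypothesis, and L(X, Y) as {linear X -> Y} likewise. *)

Definition ineq_set (R : realType) (W : normedModType R) (n : nat)
    (u : 'I_n -> {linear W -> R^o}) (s : 'I_n -> R) : set W :=
  [set x | forall k, u k x <= s k].

Definition polyhedron (R : realType) (W : normedModType R) (P : set W) : Prop :=
  exists (n : nat) (u : 'I_n -> {linear W -> R^o}) (s : 'I_n -> R),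
    (forall k, continuous (u k)) /\ P = ineq_set u s.

(* The supremum is taken in \bar R: when the functional is unbounded above
   on P it is +oo and is attained nowhere. *)
Definition face (R : realType) (W : normedModType R) (P F : set W) : Prop :=
  exists xs : {linear W -> R^o}, continuous xs /\
    F = [set u | P u /\ (xs u)%:E = ereal_sup [set (xs x)%:E | x in P]].

Definition piecewise_linear (R : realType) (X Y : normedModType R)
    (f : X -> Y) : Prop :=
  exists (m : nat) (P : 'I_m -> set X) (T : 'I_m -> {linear X -> Y})
    (b : 'I_m -> Y),
    [/\ forall i, polyhedron (P i),
        \bigcup_i P i = [set: X],
        forall i, continuous (T i)
      & forall i x, P i x -> f x = T i x + b i].

(* 0 need not belong to C, so cones with and without apex are both covered. *)
Definition convex_cone (R : realType) (Y : normedModType R) (C : set Y) : Prop :=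
  convex_set C /\ forall (r : R) (y : Y), 0 < r -> C y -> C (r *: y).

Definition set_sum (R : realType) (Y : normedModType R) (A B : set Y) : set Y :=
  [set a + b | a in A & b in B].

Definition C_convex (R : realType) (Y : normedModType R) (C D : set Y) : Prop :=
  convex_set (set_sum D C).

Definition WE (R : realType) (Y : normedModType R) (D C : set Y) : set Y :=
  [set w | D w /\ ~ exists v, D v /\ C° (w - v)].

Definition weak_pareto_sol (R : realType) (X Y : normedModType R) (C : set Y)
    (g : X -> Y) (A : set X) : set X :=
  [set x | A x /\ WE (g @` A) C (g x)].

Definition feasible (R : realType) (X : normedModType R) (l : nat)
    (phi : 'I_l -> X -> R^o) : set X :=
  [set x | forall j, phi j x <= 0].

Definition weak_pareto_face (R : realType) (X Y : normedModType R) (C : set Y)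
    (g : X -> Y) (A F : set X) : Prop :=
  face A F /\ F `<=` weak_pareto_sol C g A.

(* Main.v *)
(* If [x] is weakly efficient then [f(A) + C - f(x)] is a convex set missing
   [- int C], so it is separated from it by a continuous functional [g] that is
   positive on [int C], and [x] minimizes [g o f] over [A]. The minimizers of
   [g o f] lying in [A_i] form an exposed face of [A_i] consisting of weak
   Pareto solutions, and each polyhedron has only finitely many faces. *)

Require Import Defs.
From HB Require Import structures.
From mathcomp Require Import all_boot all_order all_algebra.
From mathcomp Require Import all_classical all_reals all_analysis.
From mathcomp Require Import lra.

Set Implicit Arguments.
Unset Strict Implicit.
Unset Printing Implicit Defensive.

Import Order.TTheory GRing.Theory Num.Theory.
Import numFieldNormedType.Exports.

Local Open Scope classical_set_scope.
Local Open Scope ring_scope.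

(** * Exposed faces of polyhedra *)

(** At a point of [P], equality with the extended supremum just means being a maximizer; later
    arguments can thus avoid [\bar R]. *)
Lemma faceP (R : realType) (W : normedModType R) (P F : set W) :
  face P F <-> exists g : {linear W -> R^o}, continuous g /\
    F = [set u | P u /\ forall x, P x -> g x <= g u].
Proof.
have supP (g : {linear W -> R^o}) u : P u ->
    (g u)%:E = ereal_sup [set (g x)%:E | x in P] <->
    forall x, P x -> g x <= g u.
  move=> Pu; split=> [gu x Px|gu].
    by rewrite -lee_fin gu; apply: ereal_sup_ubound; exists x.
  apply/eqP; rewrite eq_le; apply/andP; split.
    by apply: ereal_sup_ubound; exists u.
  by apply: ge_ereal_sup => _ [x Px <-]; rewrite lee_fin gu.
split=> -[g [gc ->]]; exists g; split=> //; apply/seteqP; split=> u [Pu gu];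
  by split=> //; apply/(supP g u Pu).
Qed.

Lemma polyhedronI (R : realType) (W : normedModType R) (P Q : set W) :
  polyhedron P -> polyhedron Q -> polyhedron (P `&` Q).
Proof.
move=> [n [u [s [uc ->]]]] [m [v [r [vc ->]]]].
exists (n + m)%N,
  (fun k : 'I_(n + m) =>
     match fintype.split k with inl i => u i | inr j => v j end),
  (fun k : 'I_(n + m) =>
     match fintype.split k with inl i => s i | inr j => r j end); split.
  by move=> k; case: (fintype.split k).
apply/seteqP; split=> x /=.
  by move=> [us vr] k; case: (fintype.split k).
move=> uv; split=> k.
  by have := uv (unsplit (inl k)); rewrite unsplitK.
by have := uv (unsplit (inr k)); rewrite unsplitK.
Qed.

(** A point [x] of the face supplies the maximal value [g x], so the single extra inequality
    [- g <= - g x] cuts the face out of [P]. *)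
Lemma face_polyhedron (R : realType) (W : normedModType R) (P F : set W) :
  polyhedron P -> F !=set0 -> face P F -> polyhedron F.
Proof.
move=> Ppoly [x Fx] /faceP[g [gc FE]].
suff -> : F = P `&` ineq_set (fun _ : 'I_1 => \- g) (fun=> - g x).
  apply: polyhedronI => //; exists 1%N, (fun=> \- g), (fun=> - g x).
  by split=> // _ y; apply: cvgN; exact: gc.
move: Fx; rewrite FE => -[Px gx]; apply/seteqP; split=> u.
  by move=> [Pu gu]; split=> // _ /=; rewrite lerN2 gu.
move=> [Pu /(_ ord0)]; rewrite /= lerN2 => xu; split=> // y Py.
exact: le_trans (gx y Py) xu.
Qed.

(* A face is cut out of the polyhedron by the constraints active on all of it:
   from a point where the other constraints are slack one can step slightly
   away from any point satisfying the active ones. *)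
Lemma face_active (R : realType) (W : normedModType R) (n : nat)
    (u : 'I_n -> {linear W -> R^o}) (s : 'I_n -> R) (F : set W) :
  face (ineq_set u s) F -> F !=set0 ->
  exists J : {set 'I_n},
    F = [set x | ineq_set u s x /\ forall k, k \in J -> u k x = s k].
Proof.
(* [J] will collect the constraints that are equalities on the whole of [F]. *)
move=> /faceP[g [gc FE]] [x1 Fx1].
have FP x : F x -> ineq_set u s x by rewrite FE => -[].
exists [set k | `[< forall x, F x -> u k x = s k >]]%SET.
(* One point makes all the other constraints strict at once: go through the indices and, whenever
   [y] in [F] is strict at [k], replace [x0] by the midpoint of [x0] and [y]. It stays in [F] and
   keeps every strictness already gained. *)
have [x0 Fx0 slack] : exists2 x0, F x0 &
    forall k, (exists2 x, F x & u k x != s k) -> u k x0 < s k.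
  have [x0 Fx0 slack] : exists2 x0, F x0 & forall k, k \in enum 'I_n ->
      (exists2 x, F x & u k x != s k) -> u k x0 < s k.
    elim: (enum 'I_n) => [|k r [x0 Fx0 IH]]; first by exists x1.
    have [[y Fy yk]|nk] := pselect (exists2 x, F x & u k x != s k); last first.
      by exists x0 => // j; rewrite in_cons => /predU1P[->|/IH].
    exists (2^-1 *: (x0 + y)); last first.
      move=> j; rewrite in_cons linearZ linearD /= => /predU1P[->|jr] jP.
        have := FP _ Fx0 k; have : u k y < s k.
          by rewrite lt_neqAle yk (FP _ Fy).
        by rewrite /GRing.scale /=; lra.
      have := IH j jr jP; have := FP _ Fy j.
      by rewrite /GRing.scale /=; lra.
    have Px0 := FP _ Fx0; have Py := FP _ Fy.
    have := Fy; have := Fx0; rewrite FE => -[_ gx0] [_ gy]; split.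
      move=> k'; rewrite linearZ linearD /=; have := Px0 k'; have := Py k'.
      by rewrite /GRing.scale /=; lra.
    move=> z Pz; rewrite linearZ linearD /=; have := gx0 z Pz; have := gy z Pz.
    by rewrite /GRing.scale /=; lra.
  by exists x0 => // k; apply: slack; rewrite mem_enum.
apply/seteqP; split=> x.
  move=> Fx; split; first exact: FP.
  by move=> k; rewrite inE => /asboolP; apply.
move=> [Px xJ].
(* Moving from [x0] in direction [x0 - x] leaves the constraints of [J] unchanged, and a small step
   respects the finitely many slack ones. *)
have [e [e0 Pe]] : exists e : R, 0 < e /\
    forall k, u k x0 + e * (u k x0 - u k x) <= s k.
  have : forall k, \forall e \near 0^'+, u k x0 + e * (u k x0 - u k x) <= s k.
    move=> k.
    have [kJ|kJ] := pselect (forall x, F x -> u k x = s k).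
      have kE : u k x = s k by apply: xJ; rewrite inE; apply/asboolP.
      by apply: nearW => e; rewrite (kJ _ Fx0) kE subrr mulr0 addr0.
    have lt_k : u k x0 < s k.
      apply: slack; apply: contrapT => nk; apply: kJ => z Fz.
      by apply/eqP; apply: contrapT => /negP zk; apply: nk; exists z.
    have d0 : 0 < `|u k x0 - u k x| + 1 by rewrite ltr_wpDl.
    have el : 0 < (s k - u k x0) / (`|u k x0 - u k x| + 1).
      by rewrite divr_gt0 ?subr_gt0.
    near=> e.
    have e0 : 0 < e by near: e; exact: nbhs_right_gt.
    have : e < (s k - u k x0) / (`|u k x0 - u k x| + 1).
      by near: e; exact: nbhs_right_lt.
    rewrite ltr_pdivlMr // => es.
    have := ler_norm (u k x0 - u k x).
    rewrite -(ler_pM2l e0) => le1; lra.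
  move=> /filter_forall /(filterI (nbhs_right_gt 0)) /filter_ex.
  by move=> [e [e0 Pe]]; exists e.
(* As [x0] maximizes [g] and [x0 + e *: (x0 - x)] is feasible, [g x0 <= g x], so [x] is a maximizer
   too. *)
rewrite FE; split=> // y Py; move: Fx0; rewrite FE => -[_ gx0].
apply: le_trans (gx0 y Py) _.
have /gx0 : ineq_set u s (x0 + e *: (x0 - x)).
  by move=> k; rewrite linearD linearZ linearB /=; exact: Pe.
rewrite linearD linearZ linearB /= /GRing.scale /=.
by rewrite gerDl pmulr_rle0 // subr_le0.
Unshelve. all: by end_near. Qed.

(** A nonempty face is determined by its set [J] of active indices, and ['I_n] has finitely many
    subsets. *)
Lemma finite_faces (R : realType) (W : normedModType R) (P : set W) :
  polyhedron P -> finite_set [set F | face P F /\ F !=set0].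
Proof.
move=> [n [u [s [_ ->]]]].
pose G (J : {set 'I_n}) :=
  [set x | ineq_set u s x /\ forall k, k \in J -> u k x = s k].
apply: (@sub_finite_set _ _ (range G)).
  by move=> F [FP /(face_active FP)[J ->]]; exists J.
exact/finite_image/finite_finset.
Qed.

(** * Interiors and convex cones *)

Lemma interior_normP (R : realType) (Y : normedModType R) (C : set Y) (x : Y) :
  C° x <-> exists2 e : R, 0 < e & forall y, `|y| < e -> C (x + y).
Proof.
rewrite /interior /=; split=> [/nbhs_normP[e /= e0 xC]|[e e0 xC]].
  by exists e => // y ye; apply: xC; rewrite /= opprD addNKr normrN.
apply/nbhs_normP; exists e => // y /= xy.
by rewrite -(subrKC x y); apply: xC; rewrite distrC.
Qed.

Lemma interior_scale (R : realType) (Y : normedModType R) (C : set Y)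
    (r : R) (x : Y) :
  (forall y, C y -> C (r *: y)) -> 0 < r -> C° x -> C° (r *: x).
Proof.
move=> Cr r0 /interior_normP[e e0 xC]; apply/interior_normP.
exists (r * e) => [|y ye]; first exact: mulr_gt0.
rewrite -[y](scalerKV (lt0r_neq0 r0)) -scalerDr; apply/Cr/xC.
by rewrite normrZ gtr0_norm ?invr_gt0// ltr_pdivrMl.
Qed.

Lemma interiorDr (R : realType) (Y : normedModType R) (C : set Y) (x y : Y) :
  (forall a b, C a -> C b -> C (a + b)) -> C° x -> C y -> C° (x + y).
Proof.
move=> CD /interior_normP[e e0 xC] Cy; apply/interior_normP; exists e => // z ze.
by rewrite addrAC; apply: CD => //; exact: xC.
Qed.

Lemma convex_setE (R : realType) (Y : normedModType R) (A : set Y) (x y : Y)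
    (r : R) :
  convex_set A -> A x -> A y -> 0 <= r <= 1 -> A (r *: x + (1 - r) *: y).
Proof.
move=> Acvx Ax Ay /andP[r0 r1].
have := Acvx x y (Itv01 r0 r1); rewrite !inE => /(_ Ax Ay).
exact.
Qed.

(** The sum is twice the midpoint. *)
Lemma convex_coneD (R : realType) (Y : normedModType R) (C : set Y) (x y : Y) :
  convex_cone C -> C x -> C y -> C (x + y).
Proof.
move=> [Ccvx Csc] Cx Cy.
have h : (0 : R) <= (2^-1 : R) <= 1.
  by rewrite invr_ge0 ler0n invf_le1 ?ler1n.
have /(Csc 2) : C (2^-1 *: x + (1 - 2^-1) *: y) by exact: convex_setE.
rewrite scalerDr !scalerA divff// mulrBr mulr1 divff// [_ - 1]addrK !scale1r.
exact.
Qed.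

(** * Positive functionals by Zorn's lemma *)

(* Zorn: a cone maximal among those avoiding [- e] contains [y] or [- y] for
   each [y]. *)
Lemma maximal_cone (R : realType) (Y : lmodType R) (K : set Y) (e : Y) :
  K 0 -> K e -> ~ K (- e) ->
  (forall x y, K x -> K y -> K (x + y)) ->
  (forall (r : R) x, 0 <= r -> K x -> K (r *: x)) ->
  exists M : set Y, [/\ K `<=` M, ~ M (- e),
    forall x y, M x -> M y -> M (x + y),
    forall (r : R) x, 0 <= r -> M x -> M (r *: x) &
    forall y, M y \/ M (- y)].
Proof.
move=> K0 Ke nKe KD KZ.
pose Q (M : set Y) := [/\ ~ M (- e), forall x y, M x -> M y -> M (x + y) &
  forall (r : R) x, 0 <= r -> M x -> M (r *: x)].
(* Ordering the sets [A] through [K]|[A] keeps [K] inside the maximal cone and covers the empty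
   chain. *)
have [] := @Zorn_bigcup _ [set A | Q (K `|` A)].
  move=> F FQ Ftot; split.
  - move=> [//|[B FB Be]]; have [n _ _] := FQ _ FB; by apply: n; right.
  - have inB B x y : F B -> (K `|` B) x -> (K `|` B) y ->
        (K `|` \bigcup_(X in F) X) (x + y).
      move=> FB Bx By; have [_ D _] := FQ _ FB.
      by have [|Bxy] := D _ _ Bx By; [left|right; exists B].
    move=> x y [Kx|[B FB Bx]] [Ky|[B' FB' By]].
    + by left; exact: KD.
    + by apply: (inB B') => //; [left|right].
    + by apply: (inB B) => //; [right|left].
    + have [BB'|B'B] := Ftot _ _ FB FB'.
        by apply: (inB B') => //; right => //; exact: BB'.
      by apply: (inB B) => //; right => //; exact: B'B.
  - move=> r x r0 [Kx|[B FB Bx]]; first by left; exact: KZ.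
    have [_ _ Z] := FQ _ FB.
    by have [|Brx] := Z _ _ r0 (or_intror Bx); [left|right; exists B].
move=> A [[nMe MD MZ] Amax]; set M := K `|` A in nMe MD MZ.
have KM : K `<=` M by left.
exists M; split=> // y; apply: contrapT => /not_orP[nMy nMNy].
(* Adjoining [y] gives a strictly larger cone. It still avoids [- e]: from [- e = a + r *: y] with
   [r > 0] would follow [- y = r^-1 *: (a + e)] in [M]. *)
pose M' : set Y :=
  [set z | exists2 a, M a & exists2 r : R, 0 <= r & z = a + r *: y].
have MM' : M `<=` M'.
  by move=> z Mz; exists z => //; exists 0; rewrite // scale0r addr0.
apply: (Amax M').
  split=> [|sub]; first by move=> z Az; apply: MM'; right.
  apply: nMy; right; apply: sub; exists 0; first exact: KM.
  by exists 1; rewrite // scale1r add0r.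
rewrite /= (_ : K `|` M' = M'); last first.
  by apply/seteqP; split=> [z [/KM/MM'|]|z]//; right.
split.
- move=> [a Ma [r r0 eE]]; have [r0'|rN0] := eqVneq r 0.
    by apply: nMe; rewrite eE r0' scale0r addr0.
  apply: nMNy; have -> : - y = r^-1 *: (a + e).
    apply: (scalerI rN0); rewrite scalerKV//.
    by rewrite -[e]opprK eE scalerN opprD addrA subrr add0r.
  by apply: MZ; [rewrite invr_ge0|apply: MD => //; exact: KM].
- move=> _ _ [a Ma [r r0 ->]] [a' Ma' [r' r0' ->]].
  exists (a + a'); first exact: MD.
  by exists (r + r'); rewrite ?addr_ge0// scalerDl addrACA.
- move=> s _ s0 [a Ma [r r0 ->]]; exists (s *: a); first exact: MZ.
  by exists (s * r); rewrite ?mulr_ge0// scalerDr scalerA.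
Qed.

Lemma small_multiple (R : realType) (Y : normedModType R) (y : Y) (d : R) :
  0 < d -> exists2 r : R, 0 < r & `|r *: y| < d.
Proof.
(* The summand 1 keeps the denominator positive when [y = 0]. *)
move=> d0; have y1 : 0 < `|y| + 1 by rewrite ltr_wpDl.
have r0 : 0 < d / (`|y| + 1) by exact: divr_gt0.
exists (d / (`|y| + 1)) => //; rewrite normrZ gtr0_norm//.
by rewrite mulrAC ltr_pdivrMr// ltr_pM2l// ltrDl.
Qed.

(* The functional is [g y = sup {t | y - t e \in M}] for the cone [M] of
   [maximal_cone]; totality of [M] gives [g (- y) = - g y]. *)
Lemma positive_functional (R : realType) (Y : normedModType R) (K : set Y)
    (e : Y) :
  K 0 -> K° e -> ~ K (- e) ->
  (forall x y, K x -> K y -> K (x + y)) ->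
  (forall (r : R) x, 0 <= r -> K x -> K (r *: x)) ->
  exists g : {linear Y -> R^o}, [/\ continuous g,
    forall y, K y -> 0 <= g y & forall y, K° y -> 0 < g y].
Proof.
move=> K0 Kie nKe KD KZ; have Ke := interior_subset Kie.
have [M [KM nMe MD MZ Mtot]] := maximal_cone K0 Ke nKe KD KZ.
have [d d0 Kd] := (interior_normP _ _).1 Kie.
have Me (r : R) : 0 <= r -> M (r *: e) by move=> r0; exact/MZ/KM.
have Me_ge0 (r : R) : M (r *: e) -> 0 <= r.
  move=> Mr; rewrite leNgt; apply/negP => r0; apply: nMe.
  have -> : - e = (- r)^-1 *: (r *: e).
    by rewrite scalerA invrN mulNr mulVf ?scaleN1r// lt_eqF.
  by apply: MZ => //; rewrite invr_ge0 oppr_ge0 ltW.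
(* Since [e] is interior to [K], [e + r *: y] lies in [K] for small [r > 0]. This makes each [S y]
   nonempty and bounded above. *)
have absorb y : exists t : R, M (t *: e + y).
  have [r r0 ry] := small_multiple y d0; exists r^-1.
  have -> : r^-1 *: e + y = r^-1 *: (e + r *: y).
    by rewrite scalerDr scalerK// lt0r_neq0.
  by apply: MZ; [rewrite invr_ge0 ltW|exact/KM/Kd].
pose S y := [set t : R | M (y - t *: e)].
have S_le y s t : S y s -> M (t *: e - y) -> s <= t.
  move=> Ss Mt; rewrite -subr_ge0; apply: Me_ge0.
  by have := MD _ _ Mt Ss; rewrite addrA subrK -scalerBl.
have S0 y : S y !=set0.
  by have [t Mt] := absorb y; exists (- t); rewrite /S /= scaleNr opprK addrC.
have Sub y : has_ubound (S y).
  by have [t Mt] := absorb (- y); exists t => s Ss; exact: S_le Ss Mt.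
pose g y : R := sup (S y).
have g_ge y t : M (y - t *: e) -> t <= g y by move=> Mt; exact: ub_le_sup.
have g_le y t : M (t *: e - y) -> g y <= t.
  by move=> Mt; apply: ge_sup => // s Ss; exact: S_le Ss Mt.
have lt_g y t : 0 < t -> M (y - (g y - t) *: e).
  move=> t0; have [s Ss gs] := sup_adherent t0 (conj (S0 y) (Sub y)).
  have -> : y - (g y - t) *: e = (y - s *: e) + (s - (g y - t)) *: e.
    by rewrite [in RHS]scalerBl addrA subrK.
  by apply: MD => //; apply: Me; rewrite subr_ge0 ltW.
(* By totality of [M] the alternative is [y - (g y + t) *: e] in [M], which would force
   [g y + t <= g y]. *)
have gt_g y t : 0 < t -> M ((g y + t) *: e - y).
  move=> t0; rewrite -opprB.
  by have [/g_ge|//] := Mtot (y - (g y + t) *: e); rewrite gerDl leNgt t0.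
(* These two-sided approximations determine [g y], so additivity, oddness and homogeneity reduce to
   closure properties of [M]. *)
have gE y a : (forall t, 0 < t ->
    M (y - (a - t) *: e) /\ M ((a + t) *: e - y)) -> g y = a.
  move=> aP; apply/eqP; rewrite eq_le.
  apply/andP; split; apply/ler_addgt0Pr => t t0.
    by apply: g_le; have [] := aP t t0.
  by rewrite -lerBlDr; apply: g_ge; have [] := aP t t0.
have gD x y : g (x + y) = g x + g y.
  apply: gE => t t0; have t2 : 0 < t / 2 by rewrite divr_gt0.
  have -> : x + y - (g x + g y - t) *: e =
      (x - (g x - t / 2) *: e) + (y - (g y - t / 2) *: e).
    by rewrite addrACA -opprD -scalerDl; congr (_ - _ *: e); lra.
  have -> : (g x + g y + t) *: e - (x + y) =
      ((g x + t / 2) *: e - x) + ((g y + t / 2) *: e - y).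
    by rewrite addrACA -opprD -scalerDl; congr (_ *: e - _); lra.
  by split; apply: MD; [exact: lt_g|exact: lt_g|exact: gt_g|exact: gt_g].
have gN y : g (- y) = - g y.
  apply: gE => t t0; split.
    by rewrite -[- g y - t]opprD scaleNr opprK addrC; exact: gt_g.
  by rewrite opprK addrC [- g y + t]addrC -opprB scaleNr; exact: lt_g.
have gZp (r : R) y : 0 < r -> g (r *: y) = r * g y.
  move=> r0; have rN0 : r != 0 by rewrite lt0r_neq0.
  apply: gE => t t0; have tr : 0 < t / r by exact: divr_gt0.
  have tE : t = r * (t / r) by rewrite mulrCA divff ?mulr1.
  rewrite {1 2}tE -mulrBr -mulrDr -!scalerA -!scalerBr.
  by split; apply: MZ; rewrite ?ltW//; [exact: lt_g|exact: gt_g].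
have glin : linear (g : Y -> R^o).
  move=> r x y; rewrite gD; congr (_ + _).
  have [r0|r0|->] := ltgtP r 0; last 2 first.
  - exact: gZp.
  - by rewrite !scale0r; have := gD 0 0; rewrite addr0; lra.
  by rewrite -[r]opprK scaleNr gN gZp ?oppr_gt0// scaleNr.
pose gl : {linear Y -> R^o} :=
  HB.pack g (GRing.isLinear.Build R Y R^o *:%R g glin).
exists gl; split.
(* For [|y| < d] both [e + y] and [e - y] lie in [K], hence [-1 <= g y <= 1]. *)
- apply: bounded_linear_continuous; exists 1; split; first exact: num_real.
  move=> N N1; apply/nbhs_norm0P; exists d => // y /= yd.
  apply: le_trans (ltW N1); rewrite ler_norml; apply/andP; split.
    by apply: g_ge; rewrite scaleN1r opprK addrC; exact/KM/Kd.
  by apply: g_le; rewrite scale1r; apply/KM/Kd; rewrite normrN.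
- by move=> y Ky; apply: g_ge; rewrite scale0r subr0; exact: KM.
(* For a small [r > 0] the point [y - r *: e] is still in [K], so [g y >= r]. *)
- move=> y /interior_normP[d' d'0 Ky]; have [r r0 re] := small_multiple e d'0.
  apply: (lt_le_trans r0); apply: g_ge; by apply/KM/Ky; rewrite normrN.
Qed.

(** * Separation and scalarization *)

(** The cone [K] generated by [D] is convex, and its interior contains that of [C];
    [positive_functional] applies to it. *)
Lemma convex_cone_separation (R : realType) (Y : normedModType R) (C D : set Y) :
  convex_cone C -> convex_set D -> C `<=` D -> C° !=set0 ->
  (forall e, C° e -> ~ D (- e)) ->
  exists g : {linear Y -> R^o}, [/\ continuous g,
    forall y, D y -> 0 <= g y & forall y, C° y -> 0 < g y].
Proof.
move=> Ccone Dcvx CD [e Ce] nD.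
pose K : set Y := [set y | exists s : R, exists2 d, 0 <= s /\ D d & y = s *: d].
have De : D e by exact: (CD _ (interior_subset Ce)).
have DK : D `<=` K by move=> y Dy; exists 1, y => //; rewrite scale1r.
have CK : C° `<=` K° by apply: interiorS; exact: subset_trans DK.
have [||||r x r0 [s [d [s0 Dd] ->]]|g [gc gK gKi]] :=
    @positive_functional _ _ K e.
- by exists 0, e => //; rewrite scale0r.
- exact: CK.
(* If [- e = s *: d], then either [s = 0] and [- e = e] lies in [D], or [s > 0] and [s^-1 *: e] is
   an interior point of [C] whose opposite [d] is in [D]. *)
- move=> [s [d [s0 Dd] eE]]; move: s0; rewrite le0r => /predU1P[s0|s0].
    have e0 : e = 0 by apply: oppr_inj; rewrite eE s0 scale0r oppr0.
    by apply: (nD _ Ce); rewrite e0 oppr0 -e0.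
  apply: (nD (s^-1 *: e)).
    apply: interior_scale => //; rewrite ?invr_gt0// => y.
    by apply: Ccone.2; rewrite invr_gt0.
  by rewrite -scalerN eE scalerK// lt0r_neq0.
- move=> _ _ [s [d [s0 Dd] ->]] [s' [d' [s'0 Dd'] ->]].
  have [ss0|ss0] := leP (s + s') 0.
    have [-> ->] : s = 0 /\ s' = 0 by split; lra.
    by exists 0, e => //; rewrite !scale0r addr0.
  have ssN0 := lt0r_neq0 ss0.
  (* The weights are normalized to a convex combination of [d] and [d']. *)
  exists (s + s'), ((s / (s + s')) *: d + (1 - s / (s + s')) *: d').
    split; first exact: ltW.
    apply: convex_setE => //.
    by rewrite divr_ge0 ?(ltW ss0)//= ler_pdivrMr// mul1r lerDl.
  rewrite scalerDr !scalerA mulrBr mulr1 mulrCA divff// mulr1.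
  by rewrite [s + s']addrC addrK.
- by exists (r * s), d; rewrite ?scalerA//; split; rewrite ?mulr_ge0.
- by exists g; split=> // y; [move/DK/gK|move/CK/gKi].
Qed.

Lemma weak_pareto_scalarization (R : realType) (X Y : normedModType R)
    (C : set Y) (f : X -> Y) (A : set X) (x : X) :
  convex_cone C -> C° !=set0 -> C_convex C (f @` A) ->
  weak_pareto_sol C f A x ->
  exists g : {linear Y -> R^o}, [/\ continuous g,
    forall y, C° y -> 0 < g y & forall z, A z -> g (f x) <= g (f z)].
Proof.
move=> Ccone Cint fAcvx [Ax [_ nv]].
pose D : set Y := [set y | set_sum (f @` A) C (f x + y)].
have CD : C `<=` D by move=> y Cy; exists (f x); [exists x|exists y].
have Dcvx : convex_set D.
  move=> y z r; rewrite !inE => Dy Dz.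
  have := fAcvx (f x + y) (f x + z) r; rewrite !inE => /(_ Dy Dz).
  have -> // : conv r (f x + y : convex_lmodType Y) (f x + z) =
    f x + conv r (y : convex_lmodType Y) z.
  rewrite /conv /= !scalerDr addrACA -scalerDl /unstable.onem.
  by rewrite [r%:num + _]addrC subrK scale1r.
have [e Ce|g [gc gD gC]] := convex_cone_separation Ccone Dcvx CD Cint.
  (* If [f x - e = f z + c], then [f x - f z = e + c] is interior to [C], so [f z] dominates
     [f x]. *)
  move=> [_ [z Az <-] [c Cc fzE]]; apply: nv; exists (f z).
  split; first by exists z.
  have -> : f x - f z = e + c.
    by apply/eqP; rewrite subr_eq -addrA [c + _]addrC fzE addrC subrK.
  by apply: interiorDr => // a b; exact: convex_coneD.
exists g; split=> // z Az; have [e Ce] := Cint.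
(* [C] may omit 0, so [f z - f x] is perturbed by an element of [C] on which [g] equals exactly
   [t]. *)
apply/ler_addgt0Pr => t t0; have ge := gC e Ce.
have : D (f z - f x + (t / g e) *: e).
  exists (f z); first by exists z.
  exists ((t / g e) *: e); last by rewrite addrA subrKC.
  by apply: Ccone.2; [exact: divr_gt0|exact: (interior_subset Ce)].
move=> /gD; rewrite linearD linearB linearZ /= /GRing.scale /=.
by rewrite divfK ?lt0r_neq0//; lra.
Qed.

(** A dominating point would have a strictly smaller value of [g]. *)
Lemma weak_pareto_of_minimizer (R : realType) (X Y : normedModType R)
    (C : set Y) (f : X -> Y) (A : set X) (x : X) (g : {linear Y -> R^o}) :
  (forall y, C° y -> 0 < g y) -> A x -> (forall z, A z -> g (f x) <= g (f z)) ->
  weak_pareto_sol C f A x.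
Proof.
move=> gC Ax gx; split=> //; split; first by exists x.
move=> [_ [[z Az <-] /gC]]; rewrite linearB subr_gt0 /= ltNge.
by rewrite gx.
Qed.

(** * The solution set as a finite union of faces *)

Theorem theorem4p4 (R : realType) (X Y : normedModType R) (m l : nat)
  (q : 'I_m -> nat)
  (f : X -> Y) (phi : 'I_l -> X -> R^o)
  (T : 'I_m -> {linear X -> Y}) (b : 'I_m -> Y)
  (us : forall i : 'I_m, 'I_(q i) -> {linear X -> R^o})
  (t : forall i : 'I_m, 'I_(q i) -> R)
  (xs : 'I_m -> 'I_l -> {linear X -> R^o}) (c : 'I_m -> 'I_l -> R)
  (P A_ : 'I_m -> set X) (C : set Y)
  (f_PL : piecewise_linear f)
  (phi_PL : forall j, piecewise_linear (phi j))
  (T_cont : forall i, continuous (T i))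
  (us_cont : forall i k, continuous (us i k))
  (xs_cont : forall i j, continuous (xs i j))
  (P_def : forall i, P i = ineq_set (us i) (t i))
  (P_cover : [set: X] = \bigcup_i P i)
  (P_int : forall i, (P i)° !=set0)
  (P_disj : forall i i', i != i' -> P i `&` (P i')° = set0)
  (f_def : forall i x, P i x -> f x = T i x + b i)
  (phi_def : forall i j x, P i x -> phi j x = xs i j x - c i j)
  (A_def : forall i, A_ i = [set x | P i x /\ forall j, xs i j x <= c i j])
  (C_cone : convex_cone C)
  (C_int : C° !=set0)
  (fA_convex : C_convex C (f @` feasible phi)) :
  exists (p : nat) (F : 'I_p -> set X),
    [/\ forall k, polyhedron (F k),
        weak_pareto_sol C f (feasible phi) = \bigcup_k F k,
        forall k, exists i : 'I_m,
          [/\ A_ i !=set0, face (A_ i) (F k)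
            & F k `<=` weak_pareto_sol C (fun x => T i x + b i) (A_ i)]
      & forall k, exists i : 'I_m,
          A_ i !=set0 /\
          weak_pareto_face C (fun x => T i x + b i) (A_ i) (F k)].
Proof.
have A_poly i : polyhedron (A_ i).
  rewrite A_def P_def; apply: polyhedronI; first by exists (q i), (us i), (t i).
  by exists l, (xs i), (c i).
have A_sub i x : A_ i x -> feasible phi x.
  rewrite A_def => -[Px xc] j.
  by rewrite (phi_def _ _ _ Px) subr_le0.
have f_A i x : A_ i x -> f x = T i x + b i.
  by rewrite A_def => -[Px _]; exact: f_def.
pose Sw := weak_pareto_sol C f (feasible phi).
(* Every nonempty face of some [A_ i] inside [Sw] is taken, whatever functional exposes it;
   finiteness is then that of the faces. *)
pose W : set (set X) :=
  [set F | exists i, [/\ face (A_ i) F, F !=set0 & F `<=` Sw]].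
have W_fin : finite_set W.
  apply: (@sub_finite_set _ _
      (\bigcup_(i in [set: 'I_m]) [set F | face (A_ i) F /\ F !=set0])).
    by move=> F [i [FA F0 _]]; exists i.
  by apply: bigcup_finite => // i _; exact: finite_faces.
have Sw_W : Sw = \bigcup_(F in W) F.
  apply/seteqP; split=> [x Swx|x [F [i [_ _ FSw]] Fx]]; last exact: FSw.
  have Ax := Swx.1.
  have [i _ Px] : (\bigcup_i P i) x by rewrite -P_cover.
  have Aix : A_ i x.
    rewrite A_def; split=> // j; rewrite -subr_le0 -(phi_def _ _ _ Px).
    exact: Ax.
  have [g [gc gC gx]] := weak_pareto_scalarization C_cone C_int fA_convex Swx.
  (* Faces are sets of maximizers, hence the sign; on [A_ i], [h] is [- g \o f] up to the constant
     [g (b i)]. *)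
  pose h : {linear X -> R^o} := \- (g \o T i).
  pose F := [set u | A_ i u /\ forall z, A_ i z -> h z <= h u].
  have hE z : A_ i z -> h z = g (b i) - g (f z).
    by move=> /f_A ->; rewrite linearD /= opprD addrCA subrr addr0.
  have Fx : F x.
    split=> // z Az; rewrite !hE// lerD2l lerN2; apply: gx; exact: A_sub Az.
  exists F => //; exists i; split; last 2 first.
  - by exists x.
  (* Each [u] in [F] satisfies [g (f u) <= g (f x)], so it minimizes [g \o f] over the whole
     feasible set. *)
  - move=> u [Au /(_ x Aix)]; rewrite !hE// lerD2l lerN2 => gu.
    apply: weak_pareto_of_minimizer gC (A_sub _ _ Au) _ => z Az.
    exact: le_trans gu (gx z Az).
  apply/faceP; exists h; split=> // z; apply: cvgN.
  by apply: continuous_comp; [exact: T_cont|exact: gc].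
have [s Ws] := (finite_seqP W).1 W_fin.
exists (size s), (tnth (in_tuple s)).
have inW k : W (tnth (in_tuple s) k) by rewrite Ws; exact: mem_tnth.
have Fprop k : exists i : 'I_m,
    [/\ A_ i !=set0, face (A_ i) (tnth (in_tuple s) k)
      & tnth (in_tuple s) k `<=` weak_pareto_sol C (fun x => T i x + b i) (A_ i)].
  have [i [Fi [x Fx] FSw]] := inW k; exists i.
  have FA : tnth (in_tuple s) k `<=` A_ i by move: Fi => /faceP[g [_ ->]] u [].
  split=> //; first by exists x; exact: FA.
  (* A point of [A_ i] dominating [u] in the subproblem is feasible and would dominate it in the
     full problem, as [f] agrees with [T i + b i] there. *)
  move=> u Fu; have Au := FA _ Fu; have [_ [_ nv]] := FSw _ Fu.
  split=> //; split; first by exists u.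
  move=> [_ [[z Az <-] uz]]; apply: nv; exists (f z); split.
    by exists z => //; exact: A_sub Az.
  by rewrite !(f_A i).
split=> // [k||k].
- have [i [Fi F0 _]] := inW k; exact: face_polyhedron (A_poly i) F0 Fi.
- rewrite -/Sw Sw_W Ws; apply/seteqP; split=> x.
    by move=> [F /= /(tnthP (in_tuple s))[k ->] Fx]; exists k.
  by move=> [k _ Fx]; exists (tnth (in_tuple s) k) => //=; exact: mem_tnth.
- by have [i [A0 Fi Fw]] := Fprop k; exists i.
Qed.
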